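(* For a paracompact Hausdorff space $X$ the games $G_{ufin}(\mathcal{O},\Omega)$ and $G^{*}_{ufin}(\mathcal{O},\Omega)$ on $X$ are equivalent.
   Context: For $A\subseteq X$ and a family $\mathcal{P}$ of subsets of $X$, $St(A,\mathcal{P})=\bigcup\{B\in\mathcal{P} : A\cap B\neq\emptyset\}$. An $\omega$-cover of $X$ is an open cover $\mathcal{U}$ such that every finite $F\subseteq X$ is contained in some member of $\mathcal{U}$. In both games players ONE and TWO play an inning for each positive integer $n$: in the $n$th inning ONE chooses an open cover $\mathcal{U}_n$ of $X$ and TWO responds with a finite subset $\mathcal{V}_n\subseteq\mathcal{U}_n$. In $G_{ufin}(\mathcal{O},\Omega)$ TWO wins the play if $\{\bigcup\mathcal{V}_n : n\in\mathbb{N}\}$ is an $\omega$-cover of $X$; otherwise ONE wins. In $G^{*}_{ufin}(\mathcal{O},\Omega)$ TWO wins the play if $\{St(\bigcup\mathcal{V}_n,\mathcal{U}_n) : n\in\mathbb{N}\}$ is an $\omega$-cover of $X$; otherwise ONE wins. Two games are equivalent if whenever one of the players has a winning strategy in one of the games, that same player has a winning strategy in the other game. *)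

(* Defs.v *)
From mathcomp Require Import all_boot all_order.
From mathcomp Require Import boolp classical_sets functions cardinality filter.
From mathcomp Require Import topology.

Set Implicit Arguments.
Unset Strict Implicit.
Unset Printing Implicit Defensive.

Local Open Scope classical_set_scope.

Section Covers.
Context {X : topologicalType}.
Implicit Types (A : set X) (P U V : set (set X)).

Definition bigU P : set X := \bigcup_(B in P) B.

Definition St A P : set X := \bigcup_(B in [set B | P B /\ A `&` B !=set0]) B.

Definition open_cover U : Prop :=
  (forall B, U B -> open B) /\ bigU U = setT.

(* X itself is allowed to be a member of an omega-cover. *)
Definition omega_cover U : Prop :=
  open_cover U /\
  forall F : set X, finite_set F -> exists2 B, U B & F `<=` B.

Definition refines V U : Prop :=
  forall B, V B -> exists2 C, U C & B `<=` C.

Definition locally_finite V : Prop :=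
  forall x : X, exists2 N : set X,
    nbhs x N & finite_set [set B | V B /\ N `&` B !=set0].

End Covers.

(* Separation is not part of paracompactness here. *)
Definition paracompact (X : topologicalType) : Prop :=
  forall U : set (set X), open_cover U ->
    exists V : set (set X),
      [/\ open_cover V, refines V U & locally_finite V].

(* In each inning ONE plays an open cover and TWO answers with a finite
   subfamily of it; a game of this kind is given by the predicate on plays
   (ONE's moves, TWO's moves) stating that TWO wins.  Innings are numbered
   from 0. *)
Definition game (X : topologicalType) : Type :=
  (nat -> set (set X)) -> (nat -> set (set X)) -> Prop.

Section Games.
Context {X : topologicalType}.
Implicit Types (U V : nat -> set (set X)) (G : game X).

Definition legal_answer (Un Vn : set (set X)) : Prop :=
  finite_set Vn /\ Vn `<=` Un.

Definition ufin_O_Omega : game X := fun U V =>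
  omega_cover (range (fun n => bigU (V n))).

Definition star_ufin_O_Omega : game X := fun U V =>
  omega_cover (range (fun n => St (bigU (V n)) (U n))).

(* A strategy for ONE maps the list of TWO's earlier answers to ONE's next
   move, and a strategy for TWO maps the nonempty list of ONE's moves so far,
   the current one last, to TWO's answer.  Moves are required to be legal only
   along plays in which the opponent obeys the rules; the values of a strategy
   at other positions are irrelevant. *)
Definition strategy : Type := seq (set (set X)) -> set (set X).

Definition winning_ONE G (s : strategy) : Prop :=
  forall V, let U := fun n => s (mkseq V n) in
    (forall n, legal_answer (U n) (V n)) ->
    (forall n, open_cover (U n)) /\ ~ G U V.

Definition winning_TWO G (s : strategy) : Prop :=
  forall U, let V := fun n => s (mkseq U n.+1) in
    (forall n, open_cover (U n)) ->
    (forall n, legal_answer (U n) (V n)) /\ G U V.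

Definition ONE_has_winning_strategy G : Prop := exists s, winning_ONE G s.

Definition TWO_has_winning_strategy G : Prop := exists s, winning_TWO G s.

Definition games_equivalent G G' : Prop :=
  (ONE_has_winning_strategy G <-> ONE_has_winning_strategy G') /\
  (TWO_has_winning_strategy G <-> TWO_has_winning_strategy G').

End Games.

Arguments ufin_O_Omega X : clear implicits.
Arguments star_ufin_O_Omega X : clear implicits.

(* Main.v *)
(** This rests on A. H. Stone's theorem that in a paracompact Hausdorff
    space every open cover [U] has an open star refinement [W].  Passing from
    [U] to [W], a finite subfamily of [W] has its star covered by a finite
    subfamily of [U], so that a star-game played on the covers [W] simulates
    the ordinary game played on the covers [U].  The other transfers use the
    same strategy, since [bigU V `<=` St (bigU V) U] whenever [V `<=` U]. *)
Require Import Defs.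
From mathcomp Require Import all_boot.
From mathcomp Require Import boolp classical_sets functions cardinality filter.
From mathcomp Require Import topology.
Import Defs.

Set Implicit Arguments.
Unset Strict Implicit.
Unset Printing Implicit Defensive.

Local Open Scope classical_set_scope.

(** * Open star refinements in paracompact Hausdorff spaces *)

Lemma filter_bigcap_finite T (I : choiceType) (D : set I) (f : I -> set T)
    (F : set_system T) : Filter F ->
  finite_set D -> (forall i, D i -> F (f i)) -> F (\bigcap_(i in D) f i).
Proof.
by move=> FF /finite_fsetP[E ->] Ff; apply: filter_bigI => i; exact: Ff.
Qed.

Section StarRefinement.
Context {X : topologicalType}.
Implicit Types (A B C : set X) (U V W : set (set X)).

(** Only finitely many members of [V] meet [N]; the complements of their closures, intersected with
    [N], give a neighbourhood of [x] missing [bigU V]. *)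
Lemma locally_finite_closure V x : locally_finite V ->
  (forall B, V B -> ~ closure B x) -> ~ closure (bigU V) x.
Proof.
move=> /(_ x)[N Nx finN] Vx clVx.
have nbhsC B : V B -> nbhs x (~` closure B).
  move=> VB; apply: open_nbhs_nbhs; split; last exact: Vx.
  exact/closed_openC/closed_closure.
set D := [set B | V B /\ N `&` B !=set0] in finN.
have nbhsI : nbhs x (\bigcap_(B in D) ~` closure B).
  by apply: filter_bigcap_finite => // B -[VB _]; exact: nbhsC.
have [y [[B VB By] [Ny /(_ B) Iy]]] := clVx _ (filterI Nx nbhsI).
apply: Iy; last exact: subset_closure.
by split=> //; exists y.
Qed.

Lemma sub_locally_finite V W : W `<=` V ->
  locally_finite V -> locally_finite W.
Proof.
move=> WV lfV x; have [N Nx finN] := lfV x; exists N => //.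
by apply: sub_finite_set finN => B [/WV].
Qed.

Lemma locally_finite_closure_finite V x : locally_finite V ->
  finite_set [set B | V B /\ closure B x].
Proof.
move=> /(_ x)[N Nx]; apply: sub_finite_set => B [VB clBx]; split=> //.
by rewrite setIC; exact: clBx.
Qed.

Lemma paracompact_hausdorff_regular x A :
  paracompact X -> hausdorff_space X -> open A -> A x ->
  exists B, [/\ open B, B x & closure B `<=` A].
Proof.
move=> pX hX oA Ax.
(* Hausdorffness makes [U] a cover: a point outside [A] has an open neighbourhood whose closure
   misses [x]. *)
pose U : set (set X) := [set B | open B /\ (~ closure B x \/ B `<=` A)].
have Ucover : open_cover U.
  split=> [B []//|]; apply/seteqP; split=> // y _.
  have [Ay|nAy] := pselect (A y); first by exists A => //; split=> //; right.
  have xy : x != y by apply/eqP => xy; apply: nAy; rewrite -xy.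
  have := hX; rewrite open_hausdorff => /(_ _ _ xy)[[P Q] /= [xP yQ]].
  move=> [oP oQ PQ0]; exists Q; last by rewrite inE in yQ.
  split=> //; left; rewrite inE in xP => /(_ P (open_nbhs_nbhs (conj oP xP))).
  by rewrite setIC => /set0P; rewrite PQ0.
have [V [[oV Vcover] VU lfV]] := pX U Ucover.
pose H := [set B | V B /\ ~ closure B x].
have nHx : ~ closure (bigU H) x.
  apply: locally_finite_closure; last by move=> B [].
  by apply: sub_locally_finite lfV => B [].
exists (~` closure (bigU H)); split=> //.
  exact/closed_openC/closed_closure.
have oH : open (bigU H) by apply: bigcup_open => B [/oV].
apply: (@subset_trans _ (~` bigU H)).
  rewrite [X in _ `<=` X](closure_id _).1; last exact: open_closedC.
  by apply: closure_subset; apply: subsetC; exact: subset_closure.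
(* A member of [V] containing a point outside [A] lies in a member of [U] not contained in [A], so
   its closure misses [x] and it belongs to [H]. *)
move=> y; apply: contra_notP => nAy.
have : bigU V y by rewrite Vcover.
move=> [B VB By]; exists B => //; split=> // clBx.
have [C [_ [nCx|CA]] BC] := VU B VB.
  by apply: nCx; exact: closure_subset BC _ clBx.
by apply: nAy; apply/CA/BC.
Qed.

(* The witness is [W x], the intersection of the chosen [C B] over the [B]
   whose closure contains [x], minus the closures not containing [x]. *)
Lemma barycentric_refinement U : paracompact X -> hausdorff_space X ->
  open_cover U -> exists2 W, open_cover W &
    forall y, exists2 C, U C & St [set y] W `<=` C.
Proof.
move=> pX hX [oU Ucover].
(* Regularity makes [U'] a cover; refining it yields a [V] whose members have closures inside
   members of [U]. *)
pose U' : set (set X) := [set B | open B /\ exists2 C, U C & closure B `<=` C].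
have U'cover : open_cover U'.
  split=> [B []//|]; apply/seteqP; split=> // y _.
  have : bigU U y by rewrite Ucover.
  move=> [C UC Cy].
  have [B [oB By BC]] := paracompact_hausdorff_regular pX hX (oU _ UC) Cy.
  by exists B => //; split=> //; exists C.
have [V [[oV Vcover] VU' lfV]] := pX U' U'cover.
have /choice[c cP] : forall B, exists C, V B -> U C /\ closure B `<=` C.
  move=> B; have [VB|nVB] := pselect (V B); last by exists set0.
  have [B' [_ [C UC B'C]] BB'] := VU' B VB; exists C => _; split=> //.
  exact: subset_trans (closure_subset BB') B'C.
pose N x := [set B | V B /\ ~ closure B x].
pose W x := \bigcap_(B in [set B | V B /\ closure B x]) c B `&`
            ~` closure (bigU (N x)).
have Wx x : W x x.
  split=> [B [VB Bx]|]; first exact: (cP B VB).2.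
  apply: locally_finite_closure; last by move=> B [].
  by apply: sub_locally_finite lfV => B [].
have oW x : open (W x).
  apply: openI; last exact/closed_openC/closed_closure.
  rewrite openE => y Iy; apply: filter_bigcap_finite.
    exact: locally_finite_closure_finite.
  move=> B [VB Bx]; apply: open_nbhs_nbhs; split; last exact: Iy.
  exact/oU/(cP B VB).1.
exists (range W).
  split=> [_ [x _ <-]//|]; apply/seteqP; split=> // x _.
  by exists (W x) => //; exists x.
move=> y; have : bigU V y by rewrite Vcover.
move=> [B VB By]; exists (c B); first exact: (cP B VB).1.
(* If [W x] contains [y], then [B] is not in [N x], so [closure B x] and [c B] is one of the sets
   intersected in [W x]. The same [c B] thus serves every [x]. *)
move=> z [_ [[x _ <-] [_ [-> [_ nNy]]]] [Iz _]].
apply: Iz; split=> //; apply: contra_notP nNy => nBx.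
by apply: subset_closure; exists B.
Qed.

(** Two barycentric refinements compose to a star refinement: if [D] meets [B] at [y], the star of
    [y] in [W] puts [B] and [D] in one member of [Z], which contains the fixed point [z] of [B] and
    so lies in the star of [z]. *)
Lemma star_refinement U : paracompact X -> hausdorff_space X ->
  open_cover U -> exists2 W, open_cover W &
    forall B, W B -> B !=set0 -> exists2 C, U C & St B W `<=` C.
Proof.
move=> pX hX Ucover.
have [Z Zcover ZU] := barycentric_refinement pX hX Ucover.
have [W Wcover WZ] := barycentric_refinement pX hX Zcover.
exists W => // B WB [z Bz]; have [C UC ZC] := ZU z; exists C => //.
move=> t [D [WD [y [By Dy]]] Dt]; have [E ZE WE] := WZ y.
apply: ZC; exists E; last by apply: WE; exists D => //; split=> //; exists y.
split=> //; exists z; split=> //.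
by apply: WE; exists B => //; split=> //; exists y.
Qed.

Lemma star_answer U W V :
  (forall B, W B -> B !=set0 -> exists2 C, U C & St B W `<=` C) ->
  legal_answer W V ->
  exists2 V', legal_answer U V' & St (bigU V) W `<=` bigU V'.
Proof.
move=> WU [finV VW].
have /choice[c cP] : forall B, exists C,
    W B -> B !=set0 -> U C /\ St B W `<=` C.
  move=> B; have [[WB B0]|h] := pselect (W B /\ B !=set0).
    by have [C UC BC] := WU B WB B0; exists C.
  by exists set0 => WB B0; case: h.
(* Empty members of [V] are dropped: they add nothing to the star, and [c] is controlled only on
   nonempty sets. *)
exists (c @` [set B | V B /\ B !=set0]).
  split; first by apply/finite_image; apply: sub_finite_set finV => B [].
  by move=> _ [B [/VW WB B0] <-]; exact: (cP B WB B0).1.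
move=> t [D [WD [y [[B VB By] Dy]]] Dt].
have B0 : B !=set0 by exists y.
exists (c B); first by exists B.
by apply: (cP B (VW _ VB) B0).2; exists D => //; split=> //; exists y.
Qed.

(** Strategies need uniform choices: [r] translates ONE's covers into the star game, [f] pulls TWO's
    answers back. *)
Lemma star_simulation : paracompact X -> hausdorff_space X ->
  exists (r : set (set X) -> set (set X))
         (f : set (set X) -> set (set X) -> set (set X)),
  forall U, open_cover U -> open_cover (r U) /\
    forall V, legal_answer (r U) V ->
      legal_answer U (f U V) /\ St (bigU V) (r U) `<=` bigU (f U V).
Proof.
move=> pX hX.
have /choice[r rP] : forall U, exists W, open_cover U -> open_cover W /\
    forall B, W B -> B !=set0 -> exists2 C, U C & St B W `<=` C.
  move=> U; have [Uc|nUc] := pselect (open_cover U); last by exists U.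
  by have [W] := star_refinement pX hX Uc; exists W.
have /choice[f fP] : forall UV : set (set X) * set (set X), exists V',
    open_cover UV.1 -> legal_answer (r UV.1) UV.2 ->
    legal_answer UV.1 V' /\ St (bigU UV.2) (r UV.1) `<=` bigU V'.
  move=> [U V] /=.
  have [[Uc lV]|h] := pselect (open_cover U /\ legal_answer (r U) V).
    by have [V' ? ?] := star_answer (rP U Uc).2 lV; exists V'.
  by exists V => Uc lV; case: h.
exists r, (fun U V => f (U, V)) => U Uc; split; first exact: (rP U Uc).1.
by move=> V lV; exact: (fP (U, V)).
Qed.

Lemma bigU_St U V : V `<=` U -> bigU V `<=` St (bigU V) U.
Proof.
move=> VU x [B VB Bx]; exists B => //; split; first exact: VU.
by exists x; split=> //; exists B.
Qed.

Lemma open_St A U : open_cover U -> open (St A U).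
Proof. by move=> [oU _]; apply: bigcup_open => B [/oU]. Qed.

Lemma open_answer U V : open_cover U -> legal_answer U V -> open (bigU V).
Proof. by move=> [oU _] [_ VU]; apply: bigcup_open => B /VU/oU. Qed.

Lemma omega_cover_sub (A B : nat -> set X) :
  (forall n, A n `<=` B n) -> (forall n, open (B n)) ->
  omega_cover (range A) -> omega_cover (range B).
Proof.
move=> AB oB [[_ Acover] Aom]; split.
  split=> [_ [n _ <-]//|]; apply/seteqP; split=> // x _.
  have : bigU (range A) x by rewrite Acover.
  by move=> [_ [n _ <-] /AB Bx]; exists (B n) => //; exists n.
move=> F /Aom[_ [n _ <-] FA]; exists (B n); first by exists n.
exact: subset_trans FA (AB n).
Qed.

End StarRefinement.

(** * Transfer of winning strategies between the games *)

Section Transfers.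
Context {X : topologicalType}.

Lemma ufin_star_ufin (U V : nat -> set (set X)) :
  (forall n, open_cover (U n)) -> (forall n, legal_answer (U n) (V n)) ->
  ufin_O_Omega X U V -> star_ufin_O_Omega X U V.
Proof.
move=> Uc lV; apply: omega_cover_sub => n; last exact: open_St.
by apply: bigU_St; exact: (lV n).2.
Qed.

Lemma TWO_ufin_star_ufin : TWO_has_winning_strategy (ufin_O_Omega X) ->
  TWO_has_winning_strategy (star_ufin_O_Omega X).
Proof.
move=> [s sP]; exists s => U V Uc; have [lV G] := sP U Uc.
by split=> //; exact: ufin_star_ufin.
Qed.

Lemma ONE_star_ufin_ufin : ONE_has_winning_strategy (star_ufin_O_Omega X) ->
  ONE_has_winning_strategy (ufin_O_Omega X).
Proof.
move=> [s sP]; exists s => V U lV; have [Uc G] := sP V lV.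
by split=> //; apply: contra_not G; exact: ufin_star_ufin.
Qed.

Hypotheses (pX : paracompact X) (hX : hausdorff_space X).

Lemma TWO_star_ufin_ufin : TWO_has_winning_strategy (star_ufin_O_Omega X) ->
  TWO_has_winning_strategy (ufin_O_Omega X).
Proof.
have [r [f rf]] := star_simulation pX hX.
(* TWO consults [s] on the refined history and pulls its answer back to ONE's current cover. The
   default [set0] is never reached, since TWO's histories are nonempty. *)
move=> [s sP]; exists (fun l => f (last set0 l) (s (map r l))) => U V Uc.
have [lV G] := sP (r \o U) (fun n => (rf _ (Uc n)).1).
have VE n : V n = f (U n) (s (mkseq (r \o U) n.+1)).
  by rewrite /V mkseqS last_rcons -mkseqS [in RHS]/mkseq map_comp.
have lV' n : legal_answer (U n) (V n).
  by rewrite VE; exact: ((rf _ (Uc n)).2 _ (lV n)).1.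
split=> //; apply: omega_cover_sub G => n; last exact: open_answer (lV' n).
by rewrite VE; exact: ((rf _ (Uc n)).2 _ (lV n)).2.
Qed.

(* A partial legal play extends to a full one by letting TWO answer with the
   empty family from then on. *)
Lemma winning_ONE_open_cover (G : game X) s (V : nat -> set (set X)) n :
  winning_ONE G s -> (forall k, k < n -> legal_answer (s (mkseq V k)) (V k)) ->
  open_cover (s (mkseq V n)).
Proof.
move=> sP lV; pose V0 k := if k < n then V k else set0.
have V0E k : k <= n -> mkseq V0 k = mkseq V k.
  move=> kn; apply/eq_in_map => i; rewrite mem_iota add0n => /= ik.
  by rewrite /V0 (leq_trans ik kn).
have lV0 k : legal_answer (s (mkseq V0 k)) (V0 k).
  have [kn|nk] := ltnP k n.
    by rewrite V0E ?(ltnW kn)// /V0 kn; exact: lV.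
  by rewrite /V0 ltnNge nk /=; split; [exact: finite_set0|exact: sub0set].
by rewrite -V0E//; exact: (sP V0 lV0).1.
Qed.

Lemma ONE_ufin_star_ufin : ONE_has_winning_strategy (ufin_O_Omega X) ->
  ONE_has_winning_strategy (star_ufin_O_Omega X).
Proof.
have [r [f rf]] := star_simulation pX hX.
move=> [s sP].
(* The accumulator is the translated history, so [s acc] is the cover to which the next answer [Vn]
   is pulled back. *)
pose tr := foldl (fun acc Vn => rcons acc (f (s acc) Vn)) [::].
exists (r \o s \o tr) => V U lV.
pose V' n := f (s (tr (mkseq V n))) (V n).
have trE n : tr (mkseq V n) = mkseq V' n.
  elim: n => [//|n IHn]; rewrite !mkseqS -IHn.
  by rewrite /tr foldl_rcons.
have UE n : U n = r (s (mkseq V' n)) by rewrite /U /= trE.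
have V'E n : V' n = f (s (mkseq V' n)) (V n) by rewrite {1}/V' trE.
(* Strong induction, because [s] is known to give open covers only after legal answers, and the
   translated answers are legal only when the earlier covers are open. *)
have sc n : open_cover (s (mkseq V' n)).
  elim/ltn_ind: n => n IHn; apply: winning_ONE_open_cover sP _ => k kn.
  rewrite V'E; apply: ((rf _ (IHn k kn)).2 (V k) _).1.
  by rewrite -UE; exact: lV.
have lV' n : legal_answer (s (mkseq V' n)) (V' n) /\
    St (bigU (V n)) (U n) `<=` bigU (V' n).
  by rewrite V'E UE; apply: (rf _ (sc n)).2; rewrite -UE; exact: lV.
split=> [n|G]; first by rewrite UE; exact: (rf _ (sc n)).1.
apply: (sP V' (fun n => (lV' n).1)).2; apply: omega_cover_sub G => n.
  exact: (lV' n).2.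
exact: open_answer (lV' n).1.
Qed.

End Transfers.

Theorem theorem5p1 (X : topologicalType)
    (X_paracompact : paracompact X) (X_hausdorff : hausdorff_space X) :
  games_equivalent (ufin_O_Omega X) (star_ufin_O_Omega X).
Proof.
split; split.
- exact: ONE_ufin_star_ufin.
- exact: ONE_star_ufin_ufin.
- exact: TWO_ufin_star_ufin.
- exact: TWO_star_ufin_ufin.
Qed.
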